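(* Let $\mathbf{p}=(p_i)_{i\ge1}$ with $p_1=0$, $p_2=1$, $p_i\in(0,1)$ for $i\ge 3$, let $q_i=1-p_i$, and let $K_n$ be the number of cycles of the random derangement process $X^{n,\mathbf{p}}$. For $n>3$, $$\mathbb{E}_{\mathbf{p}}(K_n)=\sum_{i=1}^{n-1}\sum_{j=0}^{n-i-1}(-1)^j\prod_{l=i}^{j+i}q_l.$$ If, in addition, there exists a constant $\alpha\ge 0$ such that $nq_n\to\alpha$ as $n\to\infty$, and $|\psi_\alpha(\mathbf{p})|<\infty$ for $$\psi_\alpha(\mathbf{p}):=\sum_{i=1}^\infty\left(q_i-\frac{\alpha}{i}\right)$$ (i.e. this series converges to a finite limit), then $$\lim_{n\to\infty}\bigl(\mathbb{E}_{\mathbf{p}}(K_n)-\alpha\log n\bigr)=\alpha\gamma+\psi_\alpha(\mathbf{p})+\sum_{j=1}^\infty(-1)^j\bar a_j,$$ where $\bar a_j=\sum_{i=1}^\infty\prod_{l=i}^{j+i}q_l<\infty$ for $j\in\mathbb{N}$, and $\gamma$ is the Euler constant.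
   Context: Random derangement process: for $n\ge 2$, $X^{n,\mathbf{p}}=(X_{n+1}=1,X_n,\dots,X_1)$ is the $\{0,1\}$-valued inhomogeneous Markov chain, run in decreasing index and started from $X_{n+1}=1$, such that $X_n=0$ a.s., $X_1=1$ a.s., and for $2\le r\le n-1$: $\mathbb{P}(X_r=0\mid X_{r+1}=0)=p_r$, $\mathbb{P}(X_r=1\mid X_{r+1}=0)=q_r$, $\mathbb{P}(X_r=0\mid X_{r+1}=1)=1$. The number of cycles is $K_n=\sum_{i=1}^nX_i$. $\gamma=\lim_{n\to\infty}(\sum_{i=1}^n1/i-\log n)$. *)

(* Defs.v *)
From HB Require Import structures.
From mathcomp Require Export all_boot all_order all_algebra.
From mathcomp Require Export all_classical all_reals all_analysis.
Set Implicit Arguments.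
Unset Strict Implicit.
Unset Printing Implicit Defensive.
Import Order.TTheory GRing.Theory Num.Theory.
Import numFieldNormedType.Exports.
Local Open Scope classical_set_scope.
Local Open Scope ring_scope.

Section Process.
Context (R : realType) (d : measure_display) (T : measurableType d).
Variable P : probability T R.

(* P(A | B); only meaningful when 0 < P B. *)
Definition cprob (A B : set T) : R := fine (P (A `&` B)) / fine (P B).

(* X r is the state at index r, with [false] for 0 and [true] for 1.  The chain
   runs downwards, from index n.+1 to index 1, so the past of X r consists of
   the X s with r < s <= n.+1. *)
Definition past (n : nat) (X : nat -> {RV P >-> bool}) (x : nat -> bool)
    (r : nat) : set T :=
  [set w | forall s, (r < s <= n.+1)%N -> X s w = x s].

Definition markov_chain (n : nat) (X : nat -> {RV P >-> bool}) : Prop :=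
  forall (r : nat) (x : nat -> bool), (0 < r <= n)%N ->
    (0 < P (past n X x r))%E ->
    cprob [set w | X r w = x r] (past n X x r) =
    cprob [set w | X r w = x r] [set w | X r.+1 w = x r.+1].

Record derangement_process (p : nat -> R) (n : nat)
    (X : nat -> {RV P >-> bool}) : Prop := {
  dp_markov : markov_chain n X ;
  dp_start : {ae P, forall w, X n.+1 w = true} ;
  dp_first : {ae P, forall w, X n w = false} ;
  dp_last : {ae P, forall w, X 1%N w = true} ;
  dp_00 : forall r, (2 <= r <= n.-1)%N ->
    (0 < P [set w | X r.+1 w = false])%E ->
    cprob [set w | X r w = false] [set w | X r.+1 w = false] = p r ;
  dp_01 : forall r, (2 <= r <= n.-1)%N ->
    (0 < P [set w | X r.+1 w = false])%E ->
    cprob [set w | X r w = true] [set w | X r.+1 w = false] = 1 - p r ;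
  dp_10 : forall r, (2 <= r <= n.-1)%N ->
    (0 < P [set w | X r.+1 w = true])%E ->
    cprob [set w | X r w = false] [set w | X r.+1 w = true] = 1
}.

Definition num_cycles (n : nat) (X : nat -> {RV P >-> bool}) : T -> R :=
  fun w => \sum_(1 <= i < n.+1) (X i w)%:R.

End Process.

Section Constants.
Context (R : realType).
Implicit Types (q : nat -> R) (alpha : R).

Definition euler_gamma : R :=
  limn (fun n : nat => \sum_(1 <= i < n.+1) i%:R^-1 - ln (n%:R : R)).

Definition psi_partial q alpha (n : nat) : R :=
  \sum_(1 <= i < n.+1) (q i - alpha / i%:R).

Definition psi q alpha : R := limn (psi_partial q alpha).

Definition abar q (j : nat) : \bar R :=
  (\sum_(1 <= i <oo) (\prod_(i <= l < (j + i).+1) q l)%:E)%E.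

Definition alt_abar_partial q (m : nat) : R :=
  \sum_(1 <= j < m.+1) (-1) ^+ j * fine (abar q j).

End Constants.

(* Main.v *)
(* The probabilities u_r = P(X_r = 1) satisfy u_n = 0 and
   u_r = q_r (1 - u_{r+1}), and unrolling this backward recursion gives the
   alternating sum.  For the asymptotics the sum is regrouped by the number of
   factors: the single factors contribute psi_alpha + alpha (H_n - ln n), up to
   a vanishing term.  As q_i <= C / i, while q_i <= rho < 1 for i >= 3, the sum
   over i of the products with j + 2 factors is at most C^2 rho^j, uniformly
   in n, so the remaining sum converges by Tannery's theorem. *)
Require Import Defs.
From mathcomp Require Import all_boot all_order all_algebra.
From mathcomp Require Import all_classical all_reals all_analysis.
From mathcomp Require Import measurable_realfun ring lra zify.
Import Order.TTheory GRing.Theory Num.Theory.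
Import numFieldNormedType.Exports.
Local Open Scope classical_set_scope.
Local Open Scope ring_scope.

Set Implicit Arguments.
Unset Strict Implicit.
Unset Printing Implicit Defensive.

(** * Limits of series and of harmonic sums *)

(** Dominated convergence for series whose terms and upper limit both depend on [n]. The difference
    from [series h n] is cut at a fixed [M]: the head is a finite sum of null sequences, and the
    tail is controlled by that of [g], uniformly in [n]. *)
Lemma tannery (R : realType) (f : nat -> nat -> R) (g h : nat -> R) :
  (forall n j, `|f n j| <= g j) -> cvgn (series g) ->
  (forall j, f n j @[n --> \oo] --> h j) ->
  cvgn (series h) /\
  \sum_(0 <= j < n) f n j @[n --> \oo] --> limn (series h).
Proof.
move=> fg cg fh.
have hg j : `|h j| <= g j.
  by apply: cvgr_to_le (cvg_norm (fh j)) _; near=> n.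
have ch : cvgn (series h).
  apply: normed_cvg; apply: (series_le_cvg _ _ _ cg) => [j|j|j] //=.
  exact: le_trans (hg j).
split=> //.
rewrite -[limn _]addr0.
suff fh0 : \sum_(0 <= j < n) f n j - series h n @[n --> \oo] --> (0 : R).
  apply: cvg_trans (cvgD ch fh0); apply: near_eq_cvg; near=> n.
  by rewrite /= addrC subrK.
apply/cvgrPdist_lt => e e0.
(* A quarter of [e] is taken because [|f n j - h j| <= 2 * g j] doubles the tail; the head receives
   the other [e / 2]. *)
have /cauchy_cvgP/cauchy_seriesP/(_ (e / 4)) := cg.
case; first by rewrite divr_gt0.
case=> A B; case=> [[M1 _ M1A] [M2 _ M2B]] AB.
pose M := maxn M1 M2.
have gM n : \sum_(M <= j < n) g j < e / 4.
  have [Mn|/ltnW nM] := leqP M n; last by rewrite big_geq// divr_gt0.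
  apply: le_lt_trans (ler_norm _) (AB (M, n) _).
  by split; [apply: M1A; rewrite /= leq_maxl|apply: M2B; rewrite /= (leq_trans _ Mn)// leq_maxr].
have fM : \sum_(0 <= j < M) (f n j - h j) @[n --> \oo] -->
    \sum_(0 <= j < M) (h j - h j).
  elim: (M) => [|m IH].
    by rewrite big_geq//; under eq_cvg do rewrite big_geq//; exact: cvg_cst.
  rewrite big_nat_recr//=; under eq_cvg do rewrite big_nat_recr//=.
  apply: cvgD IH _; exact: cvgB (fh m) (cvg_cst _).
have hh0 : \sum_(0 <= j < M) (h j - h j) = 0.
  by rewrite big1// => j _; rewrite subrr.
have e2 : 0 < e / 2 by rewrite divr_gt0.
move/cvgrPdist_lt : fM => /(_ _ e2); rewrite hh0 => fM.
near=> n.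
have Mn : (M <= n)%N by near: n; exists M.
rewrite sub0r normrN seriesEnat/= -sumrB (big_cat_nat (n := M))//=.
have le1 : `|\sum_(0 <= j < M) (f n j - h j)| < e / 2.
  by rewrite -normrN -sub0r; near: n.
have le2 : `|\sum_(M <= j < n) (f n j - h j)| <= 2 * \sum_(M <= j < n) g j.
  apply: le_trans (ler_norm_sum _ _ _) _; rewrite mulr_sumr.
  apply: ler_sum => j _; apply: le_trans (ler_normB _ _) _.
  by rewrite mulr_natl mulr2n lerD.
apply: le_lt_trans (ler_normD _ _) _.
have := gM n; lra.
Unshelve. all: by end_near. Qed.

(** This makes [euler_gamma], defined by [limn], a genuine limit. Both monotonicity and the lower
    bound 0 come from [ln (1 + x) <= x], at [x = -1/(n+2)] and [x = 1/(n+1)] respectively. *)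
Lemma harmonic_sub_ln_cvg (R : realType) :
  cvgn (fun n : nat => \sum_(1 <= i < n.+1) i%:R^-1 - ln (n%:R : R)).
Proof.
set u := (X in cvgn X).
apply/cvg_ex.
(* The term at index 0 involves the default value of [ln 0], so monotonicity is proved from index 1
   on. *)
suff /cvg_ex[l ul] : cvgn [sequence u n.+1]_n.
  by exists l; rewrite -cvg_shiftS.
have lnS n : ln (n.+2%:R : R) = ln n.+1%:R + ln (1 + n.+1%:R^-1).
  rewrite -lnM ?posrE ?ltr0n ?addr_gt0 ?invr_gt0//.
  by rewrite mulrDr mulr1 divff ?pnatr_eq0// -natr1.
have lnSV n : ln (n.+1%:R : R) = ln n.+2%:R + ln (1 - n.+2%:R^-1).
  have n2 : n.+2%:R != 0 :> R by rewrite pnatr_eq0.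
  rewrite -lnM ?posrE ?ltr0n ?subr_gt0 ?invf_lt1 ?ltr1n//.
  by rewrite mulrBr mulr1 divff// -[n.+2%:R]natr1 addrK.
apply: nonincreasing_is_cvgn.
  apply/nonincreasing_seqP => n; rewrite /u/= big_nat_recr//=.
  have : ln (1 - n.+2%:R^-1 : R) <= - n.+2%:R^-1.
    by apply: le_ln1Dx; rewrite ltrN2 invf_lt1 ?ltr1n.
  by rewrite (lnSV n) -addrA lerD2l opprD addrC lerD2l lerNr.
exists 0 => _ [n _ <-]; rewrite /u/= subr_ge0.
rewrite big_nat_recr//= (@le_trans _ _ (\sum_(1 <= i < n.+1) i%:R^-1))//; last first.
  by rewrite lerDl invr_ge0.
elim: n => [|n IH]; first by rewrite ln1 big_geq.
rewrite big_nat_recr//= lnS lerD// le_ln1Dx//.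
by rewrite (@lt_trans _ _ 0)// invr_gt0.
Qed.

(** * Finite sums and a uniform bound *)

(** Induction on [n - r]: inserting the expansion of [u r.+1] into [q r * (1 - u r.+1)] puts the
    factor [q r] in front of every product and flips every sign; the 1 yields the term [j = 0]. *)
Lemma alternating_sum_backward (R : comRingType) (q u : nat -> R) (n r : nat) :
  u n = 0 -> (forall i, (r <= i < n)%N -> u i = q i * (1 - u i.+1)) ->
  (r <= n)%N ->
  u r = \sum_(0 <= j < n - r) (-1) ^+ j * \prod_(r <= l < (j + r).+1) q l.
Proof.
move=> un; have [k] := ubnP (n - r); elim: k r => // k IH r kr uq.
rewrite leq_eqVlt => /predU1P[->|rn]; first by rewrite subnn big_geq.
rewrite uq ?leqnn// (IH r.+1)//; last 2 first.
- by rewrite subnS; move: kr; rewrite -subn_gt0 in rn; case: (n - r)%N rn.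
- by move=> i /andP[ri rn']; rewrite uq// rn' ltnW.
rewrite -(subnSK rn) [RHS]big_nat_recl//= expr0 mul1r add0n big_nat1 mulrBr mulr1.
congr (_ + _); rewrite -mulrN -sumrN mulr_sumr; apply: eq_bigr => j _.
rewrite [in RHS]big_ltn; last by rewrite addSn; lia.
by rewrite addSnnS exprS; ring.
Qed.

(** Both sides run over the triangle [1 <= i], [i + j < n]; the inner ranges are widened to [n] so
    that the order can be exchanged. *)
Lemma big_triangle (R : nmodType) (F : nat -> nat -> R) (n : nat) :
  \sum_(1 <= i < n) \sum_(0 <= j < n - i) F i j =
  \sum_(0 <= j < n) \sum_(1 <= i < n - j) F i j.
Proof.
under eq_big_nat do rewrite (big_nat_widen _ _ n) ?leq_subr//.
rewrite (exchange_big_dep_nat xpredT)//=; apply: congr_big_nat => // j jn.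
rewrite [RHS](@big_nat_widen _ _ _ _ _ n) ?leq_subr//.
by apply: congr_big_nat => // i i1; move: i1 jn; lia.
Qed.

(** Only the finitely many indices below [N] can exceed 1/2, and a maximum of finitely many numbers
    below 1 stays below 1. *)
Lemma eventual_bound_lt1 (R : realFieldType) (q : nat -> R) (m N : nat) :
  (forall i, (m <= i)%N -> q i < 1) ->
  (forall i, (N <= i)%N -> q i <= 2^-1) ->
  exists2 rho, 0 <= rho < 1 & forall i, (m <= i)%N -> q i <= rho.
Proof.
move=> q1 qN; pose M := \big[Num.max/2^-1]_(m <= i < N) q i.
have M2 : 2^-1 <= M by exact: bigmax_ge_id.
exists M => [|i mi].
  rewrite (le_trans _ M2)//= /M big_nat_cond; apply: bigmax_lt => [|i]; first lra.
  by rewrite andbT => /andP[mi _]; exact: q1.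
have [iN|/qN Ni] := ltnP i N; last exact: le_trans M2.
by apply: le_bigmax_seq; rewrite ?mem_index_iota ?mi.
Qed.

(** * Bounds on the products of consecutive [q l], and the alternating series *)

Section products.
Context (R : realType) (q : nat -> R) (C rho : R).
Hypothesis q_ge0 : forall i, (1 <= i)%N -> 0 <= q i.
Hypothesis q_leC : forall i, (1 <= i)%N -> i%:R * q i <= C.
Hypothesis rho01 : 0 <= rho < 1.
Hypothesis q_le_rho : forall i, (3 <= i)%N -> q i <= rho.

Let w j i := \prod_(i <= l < (j + i).+1) q l.

Let w_ge0 j i : (1 <= i)%N -> 0 <= w j i.
Proof.
move=> i1; rewrite /w big_nat_cond; apply: prodr_ge0 => l.
by rewrite andbT => /andP[il _]; apply: q_ge0; lia.
Qed.

(** The first two factors give [C / i] and [C / (i + 1)], and the other [j] have index at least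
    [i + 2 >= 3], so each is at most [rho]. Writing [1 / (i (i + 1))] as a difference makes the sum
    over [i] telescope. *)
Let w_le j i : (1 <= i)%N -> w j.+1 i <= C ^+ 2 * rho ^+ j * (i%:R^-1 - i.+1%:R^-1).
Proof.
move=> i1; rewrite /w big_ltn; last by lia.
rewrite big_ltn; last by lia.
have iR : 0 < i%:R :> R by rewrite ltr0n.
have iR1 : 0 < i.+1%:R :> R by rewrite ltr0n.
have -> : i%:R^-1 - i.+1%:R^-1 = i%:R^-1 * i.+1%:R^-1 :> R.
  by rewrite -natr1; field; rewrite natr1 !gt_eqF.
have qi k : (1 <= k)%N -> q k <= C * k%:R^-1.
  by move=> k1; rewrite ler_pdivlMr ?ltr0n// mulrC q_leC.
have C0 : 0 <= C by have := @q_leC 1%N isT; rewrite mul1r; exact/le_trans/q_ge0.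
have -> : C ^+ 2 * rho ^+ j * (i%:R^-1 * i.+1%:R^-1) =
    (C / i%:R) * ((C / i.+1%:R) * rho ^+ j) by ring.
apply: ler_pM; [exact: q_ge0| |exact: qi|].
  apply: mulr_ge0; first exact: q_ge0.
  rewrite big_nat_cond; apply: prodr_ge0 => l.
  by rewrite andbT => /andP[il _]; apply: q_ge0; lia.
apply: ler_pM; [exact: q_ge0| |exact: qi|].
  rewrite big_nat_cond; apply: prodr_ge0 => l.
  by rewrite andbT => /andP[il _]; apply: q_ge0; lia.
rewrite -[X in _ <= _ ^+ X](_ : ((j.+1 + i).+1 - i.+2 = j)%N); last by lia.
rewrite -prodr_const_nat big_nat_cond [leRHS]big_nat_cond.
apply: ler_prod => l; rewrite andbT => /andP[il _].
by rewrite q_ge0 ?q_le_rho//; lia.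
Qed.

Let W j m := \sum_(1 <= i < m) w j i.

Let W_ge0 j m : 0 <= W j m.
Proof.
rewrite /W big_nat_cond; apply: sumr_ge0 => i.
by rewrite andbT => /andP[i1 _]; exact: w_ge0.
Qed.

Let W_le j m : W j.+1 m <= C ^+ 2 * rho ^+ j.
Proof.
have Crho : 0 <= C ^+ 2 * rho ^+ j.
  by rewrite mulr_ge0 ?sqr_ge0// exprn_ge0//; case/andP: rho01.
case: m => [|m]; first by rewrite /W big_geq.
apply: (@le_trans _ _
    (C ^+ 2 * rho ^+ j * \sum_(1 <= i < m.+1) (i%:R^-1 - i.+1%:R^-1))).
  rewrite mulr_sumr /W big_nat_cond [leRHS]big_nat_cond.
  by apply: ler_sum => i; rewrite andbT => /andP[i1 _]; exact: w_le.
rewrite -[leRHS]mulr1 ler_wpM2l//.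
under eq_bigr do rewrite -opprB.
rewrite sumrN telescope_sumr// opprB invr1 lerBlDr lerDl.
by rewrite invr_ge0.
Qed.

Let W_cvg j : cvgn (W j.+1).
Proof.
apply: nondecreasing_is_cvgn.
  apply/nondecreasing_seqP => -[|m]; first by rewrite [leLHS]/W big_geq.
  by rewrite /W [leRHS]big_nat_recr//= lerDl w_ge0.
by exists (C ^+ 2 * rho ^+ j) => _ [m _ <-]; exact: W_le.
Qed.

(** The partial sums are nondecreasing and bounded, so the extended-real series is finite. The index
    [j.+1] guarantees the two factors that summability rests on. *)
Lemma abar_lim j : abar q j.+1 = (limn (W j.+1))%:E.
Proof.
rewrite /abar -EFin_lim//; congr (limn _); apply/funext => m /=.
by rewrite sumEFin.
Qed.

Lemma alternating_double_sum_cvg :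
  cvgn (alt_abar_partial q) /\
  \sum_(1 <= j < n.+1) (-1) ^+ j *
    (\sum_(1 <= i < n.+1 - j) \prod_(i <= l < (j + i).+1) q l) @[n --> \oo]
    --> limn (alt_abar_partial q).
Proof.
have -> : alt_abar_partial q =
    series (fun j => (-1) ^+ j.+1 * fine (abar q j.+1)).
  apply/funext => m; rewrite seriesEnat /alt_abar_partial/=.
  by rewrite big_add1.
(* The index [j] is shifted by one. With truncated subtraction the inner sum is empty for [n <= j],
   and [W_le] gives a geometric majorant for all [n] and [j]. *)
have /= := @tannery R (fun n j => (-1) ^+ j.+1 * W j.+1 (n - j))
  (geometric (C ^+ 2) rho) (fun j => (-1) ^+ j.+1 * fine (abar q j.+1)) _ _ _.
case.
- by move=> n j; rewrite normrM normrX normrN1 expr1n mul1r ger0_norm.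
- by apply: is_cvg_geometric_series; case/andP: rho01 => ? ?; rewrite ger0_norm.
- move=> j; apply: cvgMr; rewrite abar_lim/=.
  (* For fixed [j], replacing [n] by [n + j] turns the upper limit [n - j] into [n]. *)
  rewrite -(cvg_shiftn j) /=.
  by under eq_cvg do rewrite addnK; exact: W_cvg.
move=> c1 c2; split=> //; apply: cvg_trans c2; apply: near_eq_cvg; near=> n.
by rewrite big_add1.
Unshelve. all: by end_near. Qed.

End products.

(** * Marginal probabilities of the chain *)

Section process.
Context (R : realType) (d : measure_display) (T : measurableType d).
Variable P : probability T R.

Lemma measurable_fiber (Y : {RV P >-> bool}) (b : bool) :
  measurable [set w | Y w = b].
Proof. exact: (@measurable_funPTI _ _ _ _ Y [set b] I). Qed.

Lemma expectation_num_cycles (n : nat) (X : nat -> {RV P >-> bool}) :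
  'E_P[num_cycles n X]%E =
  (\sum_(1 <= i < n.+1) fine (P [set w | X i w = true]))%:E.
Proof.
rewrite unlock /num_cycles.
have mA i : measurable [set w | X i w = true] by exact: measurable_fiber.
rewrite (eq_integral (fun w => \sum_(1 <= i < n.+1)
    (\1_[set w | X i w = true] w)%:E)%E); last first.
  move=> w _; rewrite -sumEFin; apply: eq_bigr => i _.
  by rewrite indicE; case XE: (X i w); [rewrite mem_set|rewrite memNset//= XE].
rewrite ge0_integral_sum//=; last by move=> i; apply/measurable_EFinP; exact: measurable_indic.
rewrite -sumEFin; apply: eq_bigr => i _.
by rewrite integral_indic// setIT fineK// fin_num_measure.
Qed.

Lemma fine_prob_true_false (Y : {RV P >-> bool}) :
  fine (P [set w | Y w = false]) = 1 - fine (P [set w | Y w = true]).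
Proof.
rewrite (_ : [set w | Y w = false] = ~` [set w | Y w = true]); last first.
  by apply/seteqP; split=> w /=; case: (Y w).
rewrite probability_setC; last exact: measurable_fiber.
by rewrite fineB// fin_num_measure//; exact: measurable_fiber.
Qed.

Lemma fine_prob_ae (Y : {RV P >-> bool}) (b : bool) :
  {ae P, forall w, Y w = b} -> fine (P [set w | Y w = b]) = 1.
Proof.
move=> Yb; have mY := measurable_fiber Y b.
have : P (~` [set w | Y w = b]) = 0%E by apply/negligibleP => //; exact: measurableC.
move/(congr1 fine); rewrite probability_setC// fineB ?fin_num_measure//=.
by move/eqP; rewrite subr_eq0 => /eqP.
Qed.

Variables (p : nat -> R) (n : nat) (X : nat -> {RV P >-> bool}).
Hypothesis dpX : derangement_process p n X.

Let u (r : nat) : R := fine (P [set w | X r w = true]).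

Lemma derangement_prob_first : u n = 0.
Proof.
have := fine_prob_ae (dp_first dpX); rewrite fine_prob_true_false /u; lra.
Qed.

(** Total probability over the state at [r.+1]: a 1 there forces a 0 at [r], so only the state 0
    contributes. Null conditioning events are treated apart, since the transition laws assume
    positive probability. *)
Lemma derangement_prob_step (r : nat) : (2 <= r <= n.-1)%N ->
  u r = (1 - p r) * (1 - u r.+1).
Proof.
move=> rn; rewrite /u -fine_prob_true_false.
pose A b := [set w | X r w = b]; pose B b := [set w | X r.+1 w = b].
have mA b : measurable (A b) by exact: measurable_fiber.
have mB b : measurable (B b) by exact: measurable_fiber.
have fin b c : P (A b `&` B c) \is a fin_num by rewrite fin_num_measure//; exact: measurableI.
have finB c : P (B c) \is a fin_num by rewrite fin_num_measure//.
have split1 (C : set T) : measurable C -> forall Y : {RV P >-> bool},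
  P C = (P (C `&` [set w | Y w = true]) + P (C `&` [set w | Y w = false]))%E.
  move=> mC Y; rewrite -measureU//; last 3 first.
  - by apply: measurableI => //; exact: measurable_fiber.
  - by apply: measurableI => //; exact: measurable_fiber.
  - by apply/seteqP; split=> w //= -[[_ ->] []].
  by congr (P _); apply/seteqP; split=> w /=; case: (Y w); tauto.
have P0I (b c : bool) : P (B c) = 0%E -> P (A b `&` B c) = 0%E.
  by move=> B0; apply: subset_measure0 B0 => //; exact: measurableI.
have -> : P (A true) = (P (A true `&` B true) + P (A true `&` B false))%E by exact: split1.
have -> : P (A true `&` B true) = 0%E.
  have [/P0I->//|B0] := eqVneq (P (B true)) 0%E.
  have Bgt : (0 < P (B true))%E by rewrite lt0e B0 measure_ge0.
  have := dp_10 dpX rn Bgt; rewrite /cprob -/(A false) -/(B true).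
  have Bf : fine (P (B true)) != 0 by rewrite fine_eq0.
  move/(congr1 ( *%R^~ (fine (P (B true))))); rewrite mulfVK// mul1r => e.
  (* By [e], the part of [B true] inside [A false] already has the full mass of [B true], so the
     part inside [A true] is null. *)
  have := split1 _ (mB true) (X r); rewrite setIC -/(A true) (setIC _ (A false)).
  rewrite -[P (A true `&` _)]fineK// -[P (A false `&` _)]fineK// e -[LHS]fineK// -EFinD.
  by move=> [/eqP]; rewrite -subr_eq0 opprD addrCA subrr addr0 oppr_eq0 => /eqP->.
rewrite add0e -/(B false).
have [B0|B0] := eqVneq (P (B false)) 0%E; first by rewrite B0 (P0I _ _ B0) mulr0.
have Bgt : (0 < P (B false))%E by rewrite lt0e B0 measure_ge0.
rewrite -(dp_01 dpX rn Bgt) /cprob -/(A true) -/(B false) mulfVK//.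
by rewrite fine_eq0.
Qed.

End process.

(** * Exact expectation and its asymptotics *)

Lemma expectation_derangement (R : realType) (p q : nat -> R)
    (d : measure_display) (T : measurableType d) (P : probability T R)
    (n : nat) (X : nat -> {RV P >-> bool}) :
  p 1%N = 0 -> p 2%N = 1 -> (forall i, q i = 1 - p i) -> (3 < n)%N ->
  derangement_process p n X ->
  'E_P[num_cycles n X]%E =
  (\sum_(1 <= i < n) \sum_(0 <= j < n - i)
     (-1) ^+ j * \prod_(i <= l < (j + i).+1) q l)%:E.
Proof.
move=> p1 p2 qE n3 dpX; rewrite expectation_num_cycles; congr EFin.
pose u r := fine (P [set w | X r w = true]).
have un : u n = 0 by exact: derangement_prob_first dpX.
have ustep r : (2 <= r <= n.-1)%N -> u r = q r * (1 - u r.+1).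
  by move=> rn; rewrite qE; exact: derangement_prob_step dpX _ rn.
(* The transition laws start at index 2, but the recursion extends to 1: [q 2 = 0] gives [u 2 = 0],
   and [q 1 = 1] then matches [X 1 = 1] almost surely. *)
have u1 : u 1%N = q 1%N * (1 - u 2%N).
  have -> : u 1%N = 1 by exact: fine_prob_ae (dp_last dpX).
  rewrite ustep; last lia.
  by rewrite !qE p1 p2; ring.
rewrite big_nat_recr/=; last by lia.
rewrite -/(u n) un addr0; apply: congr_big_nat => // r r1.
apply: (alternating_sum_backward (u := u)) => //; last by lia.
move=> i ri; have [->//|i1] := eqVneq i 1%N.
by apply: ustep; lia.
Qed.

Theorem lemma3 (R : realType) (p q : nat -> R)
  (hp1 : p 1%N = 0) (hp2 : p 2%N = 1)
  (hp : forall i : nat, (3 <= i)%N -> 0 < p i < 1)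
  (hq : forall i : nat, q i = 1 - p i)
  (d : nat -> measure_display) (T : forall n : nat, measurableType (d n))
  (P : forall n : nat, probability (T n) R)
  (X : forall n : nat, nat -> {RV (P n) >-> bool})
  (hX : forall n : nat, (2 <= n)%N -> derangement_process p n (X n)) :
  (forall n : nat, (3 < n)%N ->
     ('E_(P n)[num_cycles n (X n)] =
      (\sum_(1 <= i < n) \sum_(0 <= j < n - i)
         (-1) ^+ j * \prod_(i <= l < (j + i).+1) q l)%:E)%E) /\
  (forall alpha : R, 0 <= alpha ->
     (n%:R * q n @[n --> \oo] --> alpha) ->
     cvgn (psi_partial q alpha) ->
     [/\ (forall j : nat, (1 <= j)%N -> (abar q j < +oo)%E),
         cvgn (alt_abar_partial q) &
         fine ('E_(P n)[num_cycles n (X n)])%E - alpha * ln n%:R @[n --> \oo]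
           --> alpha * euler_gamma R + psi q alpha
               + limn (alt_abar_partial q)]).
Proof.
have expE n : (3 < n)%N -> ('E_(P n)[num_cycles n (X n)] =
    (\sum_(1 <= i < n) \sum_(0 <= j < n - i)
       (-1) ^+ j * \prod_(i <= l < (j + i).+1) q l)%:E)%E.
  by move=> n3; apply: (expectation_derangement hp1 hp2 hq n3); apply: hX; lia.
split=> // alpha _ nq_alpha psi_cvg.
have q_ge0 i : (1 <= i)%N -> 0 <= q i.
  rewrite hq; case: i => [|[|[|i]]]// _; rewrite ?hp1 ?hp2 ?subr0 ?subrr//.
  by have /andP[_ p1] := hp i.+3 isT; rewrite subr_ge0 ltW.
have q_lt1 i : (3 <= i)%N -> q i < 1.
  by move=> /hp /andP[p0 _]; rewrite hq ltrBlDr ltrDl.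
have [C q_leC] : exists C, forall i, (1 <= i)%N -> i%:R * q i <= C.
  have nq_bounded : bounded_fun (fun n => n%:R * q n).
    by apply: cvg_seq_bounded; apply/cvg_ex; exists alpha.
  have [C _ nqC] := pinfty_ex_gt0 nq_bounded.
  by exists C => i _; apply: le_trans (ler_norm _) (nqC i I).
have [rho rho01 q_le_rho] : exists2 rho : R, 0 <= rho < 1 &
    forall i, (3 <= i)%N -> q i <= rho.
  (* Beyond this threshold [i > 2 * C], so [q i <= C / i] falls below 1/2. *)
  apply: (@eventual_bound_lt1 _ _ _ (Num.truncn (2 * C)).+1) => // i Ci.
  have i1 : (1 <= i)%N by lia.
  have i0 : 0 < i%:R :> R by rewrite ltr0n.
  have iC : 2 * C < i%:R.
    by rewrite (lt_le_trans (truncnS_gt _))// ler_nat.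
  rewrite -(ler_pM2l i0) (le_trans (q_leC _ i1))//; lra.
have [alt_cvg sum_cvg] := alternating_double_sum_cvg q_ge0 q_leC rho01 q_le_rho.
split=> // [[//|j] _|]; first by rewrite (abar_lim q_ge0 q_leC rho01 q_le_rho) ltry.
rewrite -cvg_shiftS.
have gamma_cvg : \sum_(1 <= i < n.+2) i%:R^-1 - ln (n.+1%:R : R)
    @[n --> \oo] --> euler_gamma R.
  rewrite (cvg_shiftS (fun n : nat => \sum_(1 <= i < n.+1) i%:R^-1 - ln (n%:R : R))).
  exact: harmonic_sub_ln_cvg.
(* After the shift, the harmonic sum in the Euler constant runs to [n.+1] but the one in
   [psi_partial] stops at [n]; this is the leftover term. *)
have inv_cvg : alpha * n.+1%:R^-1 @[n --> \oo] --> (0 : R).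
  by rewrite -(mulr0 alpha); apply: cvgMr; exact: cvg_harmonic.
have alpha_gamma_cvg : alpha * (\sum_(1 <= i < n.+2) i%:R^-1 - ln n.+1%:R)
    @[n --> \oo] --> alpha * euler_gamma R by exact: cvgMr gamma_cvg.
rewrite -[alpha * _ + _]subr0.
apply: cvg_trans (cvgD (cvgB (cvgD alpha_gamma_cvg psi_cvg) inv_cvg) sum_cvg).
apply: near_eq_cvg; near=> n.
have n3 : (3 < n.+1)%N by rewrite ltnS; near: n; exists 3%N.
rewrite /= expE//= big_triangle.
(* The slice [j = 0], the plain sum of the [q i], is split off to be matched with [psi_partial]; the
   slices [j >= 1] are those of [sum_cvg]. *)
rewrite [in RHS]big_ltn//= subn0.
under [X in _ = X + _ - _]eq_bigr do rewrite expr0 mul1r add0n big_nat1.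
under [X in _ = _ + X - _]eq_bigr do rewrite -mulr_sumr.
rewrite !fctE /psi_partial sumrB -mulr_sumr [in LHS]big_nat_recr//=.
ring.
Unshelve. all: by end_near. Qed.
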